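(* The following assertions hold. (i) Every multiplicative lattice is liftable to a weak ideal system. (ii) Every multiplicative lattice which is liftable to an ideal system is generated by meet principal elements. (iii) Every multiplicative lattice $L$ which is a domain lattice (i.e. $ab=0$ with $a,b\in L$ implies $a=0$ or $b=0$) and which is generated by principal elements is liftable to an ideal system.
   Context: A multiplicative lattice is a complete lattice $L$ with least element $0$ and greatest element $1$, equipped with a commutative monoid operation with identity $1$ that is completely join distributive: $x\cdot\bigvee A=\bigvee_{a\in A}xa$ for all $x\in L$, $A\subseteq L$. Isomorphism of multiplicative lattices means a bijection preserving and reflecting the order and preserving multiplication. A subset $C\subseteq L$ generates $L$ if every element of $L$ is a join of some (possibly infinitely many, possibly no) elements of $C$; ''$L$ is generated by (meet) principal elements'' means that the set of (meet) principal elements of $L$ generates $L$. For $a,b\in L$, $(a:b)$ is the join of all $y\in L$ with $by\le a$. An element $x\in L$ is meet principal if $a\wedge xb=x((a:x)\wedge b)$ for all $a,b\in L$; it is join principal if $a\vee(b:x)=((ax\vee b):x)$ for all $a,b\in L$; it is principal if it is both meet principal and join principal. A monoid means a commutative monoid with identity $1$ and zero element $0$ (so $0x=0$ for all $x$). Let $H$ be a monoid, $\mathcal{P}(H)$ its power set. A weak ideal system on $H$ is a map $r:\mathcal{P}(H)\to\mathcal{P}(H)$, $X\mapsto X_r$, such that: (s1) $XH\subseteq X_r$ for all $X\subseteq H$; (s2) $X\subseteq Y\subseteq H$ implies $X_r\subseteq Y_r$; (s3) $(X_r)_r=X_r$ for all $X\subseteq H$; (s4) $cX_r\subseteq(cX)_r$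 for all $X\subseteq H$, $c\in H$. It is called an ideal system if equality always holds in (s4). The set $I_r(H)=\{X_r\mid X\subseteq H\}$ of $r$-ideals is a multiplicative lattice ordered by inclusion, with multiplication $(X,Y)\mapsto(XY)_r$, where $XY=\{xy\mid x\in X,y\in Y\}$, join $\bigvee\Gamma=(\bigcup\Gamma)_r$ and meet $\bigwedge\Gamma=\bigcap\Gamma$ for $\Gamma\subseteq I_r(H)$ (with empty meet equal to $H$). A multiplicative lattice $L$ is liftable to a weak ideal system (resp. to an ideal system) if there exist a monoid $H$ and a weak ideal system (resp. an ideal system) $r$ on $H$ such that the multiplicative lattice $I_r(H)$ is isomorphic to $L$. *)

(* Defs.v *)
From HB Require Import structures.
From mathcomp Require Import all_boot all_order.
From mathcomp Require Import boolp classical_sets.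

Set Implicit Arguments.
Unset Strict Implicit.
Unset Printing Implicit Defensive.

Import Order.TTheory.

Local Open Scope classical_set_scope.
Local Open Scope order_scope.
Local Open Scope group_scope.

(* Carriers are choiceTypes and orders are bool-valued; under the axioms of    *)
(* boolp this restricts neither the types nor the orders considered.           *)

HB.mixin Record isCompleteLattice (d : Order.disp_t) L of Order.TBLattice d L
  := {
  bigjoin : set L -> L;
  bigmeet : set L -> L;
  bigjoinP : forall A, supremums A (bigjoin A);
  bigmeetP : forall A, infimums A (bigmeet A)
}.

#[short(type="completeLatticeType")]
HB.structure Definition CompleteLattice (d : Order.disp_t) :=
  { L of Order.TBLattice d L & isCompleteLattice d L }.

HB.mixin Record Monoid_isCommutative M of Monoid M := {
  mulmC : commutative (@mul M)
}.

#[short(type="comMonoidType")]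
HB.structure Definition ComMonoid := { M of Monoid M & Monoid_isCommutative M }.

HB.mixin Record hasAbsorbing M of ComMonoid M := {
  absorbing : M;
  mul0m : left_zero absorbing (@mul M)
}.

(* Possibly trivial: 0 = 1 is not excluded. *)
#[short(type="comMonoid0Type")]
HB.structure Definition ComMonoid0 := { M of ComMonoid M & hasAbsorbing M }.

HB.mixin Record isMultLattice (d : Order.disp_t) L
    of CompleteLattice d L & ComMonoid L := {
  one_top : (1 : L) = \top;
  mul_bigjoin : forall (x : L) (A : set L),
    x * bigjoin A = bigjoin [set x * a | a in A]
}.

#[short(type="multLatticeType")]
HB.structure Definition MultLattice (d : Order.disp_t) :=
  { L of CompleteLattice d L & ComMonoid L & isMultLattice d L }.

Section MultLatticeNotions.
Context (d : Order.disp_t) (L : multLatticeType d).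
Implicit Types (a b x y : L) (C : set L).

Definition generates C : Prop :=
  forall x, exists2 A : set L, A `<=` C & x = bigjoin A.

(* (a : b) *)
Definition residual a b : L := bigjoin [set y | b * y <= a].

Definition meet_principal x : Prop :=
  forall a b, a `&` (x * b) = x * (residual a x `&` b).

Definition join_principal x : Prop :=
  forall a b, a `|` residual b x = residual ((a * x) `|` b) x.

Definition principal x : Prop := meet_principal x /\ join_principal x.

Definition domain_lattice : Prop :=
  forall a b, a * b = \bot -> a = \bot \/ b = \bot.

End MultLatticeNotions.

Arguments generates {d L} C.
Arguments domain_lattice {d} L.

Definition mult_lattice_iso (d d' : Order.disp_t)
    (L : multLatticeType d) (L' : multLatticeType d') : Prop :=
  exists f : L -> L',
    [/\ bijective f, {mono f : x y / x <= y} & {morph f : x y / x * y}].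

Section SetProduct.
Context (M : comMonoidType).

Definition mulset (X Y : set M) : set M := [set x * y | x in X & y in Y].

Definition scaleset (c : M) (X : set M) : set M := [set c * x | x in X].

Lemma mulsetC X Y : mulset X Y = mulset Y X.
Proof.
by apply/seteqP; split=> _ [x Xx [y Yy <-]]; exists y => //; exists x => //;
   rewrite mulmC.
Qed.

Lemma mulsetA X Y Z : mulset X (mulset Y Z) = mulset (mulset X Y) Z.
Proof.
apply/seteqP; split.
- move=> _ [x Xx [_ [y Yy [z Zz <-]] <-]]; exists (x * y).
    by exists x => //; exists y.
  by exists z => //; rewrite mulgA.
- move=> _ [_ [x Xx [y Yy <-]] [z Zz <-]]; exists x => //.
  by exists (y * z); [exists y => //; exists z | rewrite mulgA].
Qed.

Lemma mulset_subr X Y Z : Y `<=` Z -> mulset X Y `<=` mulset X Z.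
Proof. by move=> YZ _ [x Xx [y Yy <-]]; exists x => //; exists y => //; apply: YZ. Qed.

End SetProduct.

(* Since mulset set0 setT = set0, the closure of set0 may be empty. *)
Record weakIdealSystem (H : comMonoid0Type) := WeakIdealSystem {
  rclos :> set H -> set H;
  rclos_absorb : forall X, mulset X setT `<=` rclos X;
  rclos_mono : forall X Y, X `<=` Y -> rclos X `<=` rclos Y;
  rclos_idem : forall X, rclos (rclos X) = rclos X;
  rclos_scale : forall c X, scaleset c (rclos X) `<=` rclos (scaleset c X)
}.

Definition ideal_system (H : comMonoid0Type) (r : weakIdealSystem H) : Prop :=
  forall c X, scaleset c (r X) = r (scaleset c X).

(* I_r(H) = {X_r | X a subset of H}, as a type *)
Definition rideal (H : comMonoid0Type) (r : weakIdealSystem H) : Type :=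
  set_type (range r).

Section RIdealLattice.
Context (H : comMonoid0Type) (r : weakIdealSystem H).
Implicit Types (X Y : set H) (I J K : rideal r) (G : set (rideal r)).

HB.instance Definition _ := SubChoice.on (rideal r).

(* The order inherited from inclusion of subsets of H. *)
HB.instance Definition _ :=
  [SubChoice_isSubPOrder of rideal r by <: with set_display].

Lemma rideal_leP I J : reflect (val I `<=` val J) (I <= J).
Proof. by rewrite -Order.le_val; exact: subsetPset. Qed.

Lemma rclos_in X : r X \in range r.
Proof. by apply/mem_set; exists X. Qed.

Definition mk_rideal X : rideal r := Sub (r X) (rclos_in X).

Lemma val_mk X : val (mk_rideal X) = r X.
Proof. by rewrite SubK. Qed.

Lemma rideal_fix I : r (val I) = val I.
Proof. by have /set_mem [X _ <-] := valP I; rewrite rclos_idem. Qed.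

Lemma sub_rclos X : X `<=` r X.
Proof. by move=> x Xx; apply: rclos_absorb; exists x => //; exists 1 => //; rewrite mulg1. Qed.

Lemma rclos_sub X I : r X `<=` val I <-> X `<=` val I.
Proof.
split=> [rXI|XI]; first exact: subset_trans (@sub_rclos X) rXI.
by rewrite -rideal_fix; exact: rclos_mono.
Qed.

Lemma rideal_meet_in I J : (val I `&` val J)%classic \in range r.
Proof.
apply/mem_set; exists (val I `&` val J)%classic => //.
apply/seteqP; split; last exact: sub_rclos.
by move=> x rx; split; rewrite -rideal_fix; apply: rclos_mono rx => y [].
Qed.

Definition rideal_meet I J : rideal r :=
  Sub (val I `&` val J)%classic (rideal_meet_in I J).
Definition rideal_join I J : rideal r := mk_rideal (val I `|` val J)%classic.

Fact rideal_meetP I J K : (I <= rideal_meet J K) = (I <= J) && (I <= K).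
Proof.
apply/idP/andP => [|[]] => [/rideal_leP|/rideal_leP IJ /rideal_leP IK].
  by rewrite SubK subsetI => -[? ?]; split; apply/rideal_leP.
by apply/rideal_leP; rewrite SubK subsetI.
Qed.

Fact rideal_joinP I J K : (rideal_join I J <= K) = (I <= K) && (J <= K).
Proof.
apply/idP/andP => [|[]] => [/rideal_leP|/rideal_leP IK /rideal_leP JK].
  rewrite val_mk => /rclos_sub; rewrite subUset => -[? ?].
  by split; apply/rideal_leP.
by apply/rideal_leP; rewrite val_mk; apply/rclos_sub; rewrite subUset.
Qed.

HB.instance Definition _ :=
  @Order.POrder_MeetJoin_isLattice.Build set_display (rideal r)
    rideal_meet rideal_join rideal_meetP rideal_joinP.

Fact rideal_le0 I : mk_rideal set0 <= I.
Proof. by apply/rideal_leP; rewrite val_mk; apply/rclos_sub. Qed.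

Fact rideal_le1 I : I <= mk_rideal setT.
Proof. by apply/rideal_leP; rewrite val_mk => x _; exact: sub_rclos. Qed.

HB.instance Definition _ :=
  Order.hasBottom.Build set_display (rideal r) rideal_le0.
HB.instance Definition _ :=
  Order.hasTop.Build set_display (rideal r) rideal_le1.

Definition rideal_bigjoin G : rideal r := mk_rideal (\bigcup_(I in G) val I).

Lemma rideal_bigmeet_in G : \bigcap_(I in G) val I \in range r.
Proof.
apply/mem_set; exists (\bigcap_(I in G) val I) => //.
apply/seteqP; split; last exact: sub_rclos.
by move=> x rx I GI; rewrite -rideal_fix; apply: rclos_mono rx => y; apply.
Qed.

(* For G = set0 the intersection is setT, i.e. H. *)
Definition rideal_bigmeet G : rideal r :=
  Sub (\bigcap_(I in G) val I) (rideal_bigmeet_in G).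

Fact rideal_bigjoinP G : supremums G (rideal_bigjoin G).
Proof.
split=> [I GI|J JG]; apply/rideal_leP; rewrite val_mk.
  by move=> x Ix; apply: sub_rclos; exists I.
by apply/rclos_sub => x [I GI Ix]; move/rideal_leP: (JG I GI); apply.
Qed.

Fact rideal_bigmeetP G : infimums G (rideal_bigmeet G).
Proof.
split=> [I GI|J JG]; apply/rideal_leP; rewrite SubK.
  by move=> x; apply.
by move=> x Jx I GI; move/rideal_leP: (JG I GI); apply.
Qed.

HB.instance Definition _ :=
  isCompleteLattice.Build set_display (rideal r)
    rideal_bigjoinP rideal_bigmeetP.

Lemma rclos_mulsetr X Y : r (mulset X (r Y)) = r (mulset X Y).
Proof.
apply/seteqP; split; last exact/rclos_mono/mulset_subr/sub_rclos.
rewrite -[X in _ `<=` X]rclos_idem; apply: rclos_mono => _ [x Xx [y rYy <-]].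
have : r (scaleset x Y) (x * y) by apply: rclos_scale; exists y.
by apply: rclos_mono => _ [z Yz <-]; exists x => //; exists z.
Qed.

Lemma rclos_mulsetl X Y : r (mulset (r X) Y) = r (mulset X Y).
Proof. by rewrite mulsetC rclos_mulsetr mulsetC. Qed.

Definition rideal_mul I J : rideal r := mk_rideal (mulset (val I) (val J)).
Definition rideal_one : rideal r := mk_rideal setT.

Fact rideal_mulC : commutative rideal_mul.
Proof. by move=> I J; rewrite /rideal_mul mulsetC. Qed.

Fact rideal_mulA : associative rideal_mul.
Proof.
by move=> I J K; apply: val_inj; rewrite !val_mk rclos_mulsetr rclos_mulsetl mulsetA.
Qed.

Fact rideal_mul1 : left_id rideal_one rideal_mul.
Proof.
move=> I; apply: val_inj; rewrite !val_mk rclos_mulsetl mulsetC.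
apply/seteqP; split.
  by apply/rclos_sub; rewrite -[X in _ `<=` X]rideal_fix; exact: rclos_absorb.
by move=> x Ix; apply: sub_rclos; exists x => //; exists 1 => //; rewrite mulg1.
Qed.

Fact rideal_mul1r : right_id rideal_one rideal_mul.
Proof. by move=> I; rewrite rideal_mulC rideal_mul1. Qed.

HB.instance Definition _ :=
  isMonoid.Build (rideal r) rideal_mulA rideal_mul1 rideal_mul1r.
HB.instance Definition _ := Monoid_isCommutative.Build (rideal r) rideal_mulC.

Fact rideal_one_top : (1 : rideal r) = \top.
Proof. by []. Qed.

Fact rideal_mul_bigjoin (I : rideal r) (G : set (rideal r)) :
  I * bigjoin G = bigjoin [set I * J | J in G].
Proof.
apply: val_inj; rewrite [LHS]val_mk [val (bigjoin G)]val_mk rclos_mulsetr.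
rewrite [RHS]val_mk; apply/seteqP; split.
  apply: rclos_mono => _ [x Ix [y [J GJ Jy] <-]].
  exists (I * J); first by exists J.
  by rewrite [val _]val_mk; apply: sub_rclos; exists x => //; exists y.
rewrite -[X in _ `<=` X]rclos_idem; apply: rclos_mono => x [_ [J GJ <-]].
rewrite [val _]val_mk; apply: rclos_mono; apply: mulset_subr => y Jy.
by exists J.
Qed.

HB.instance Definition _ :=
  isMultLattice.Build set_display (rideal r) rideal_one_top rideal_mul_bigjoin.

End RIdealLattice.

Definition liftable_to_weak_ideal_system (d : Order.disp_t)
    (L : multLatticeType d) : Prop :=
  exists (H : comMonoid0Type) (r : weakIdealSystem H),
    mult_lattice_iso (rideal r) L.

Definition liftable_to_ideal_system (d : Order.disp_t)
    (L : multLatticeType d) : Prop :=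
  exists (H : comMonoid0Type) (r : weakIdealSystem H),
    ideal_system r /\ mult_lattice_iso (rideal r) L.

(* Main.v *)
Require Import Defs.
From HB Require Import structures.
From mathcomp Require Import all_boot all_order.
From mathcomp Require Import boolp classical_sets.

(** A multiplicative map [j] from a monoid [H] with zero to a multiplicative
    lattice [L] induces a weak ideal system on [H]: the closure of [X] consists
    of the [y] with [j y <= \/ j X]. If the range of [j] generates [L], then an
    element of [L] is determined by the elements of [H] lying below it, so
    [I |-> \/ j I] is an isomorphism from the lattice of ideals onto [L]
    ([pullback_iso]). Any generating submonoid [C] of [L] that contains the
    bottom can serve as [H].

    (i) Take for [C] all of [L].

    (ii) In an ideal system the product of the ideal generated by [c] with [J]
    is the plain set [cJ]. An ideal [K] inside [cJ] therefore consists of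
    multiples [ch] with [h] in [J], so it is the product of the ideal of [c]
    with a smaller ideal than [J]. This factorization property characterizes
    meet principal elements ([meet_principalP]), and it visibly passes through
    isomorphisms. Every ideal is the join of the ideals of its elements.

    (iii) Take for [C] the principal elements, which are closed under product.
    The induced system is an ideal system as soon as [y <= cu] with [c], [y] in
    [C] forces [y = cz] for some [z] in [C] with [z <= u]. Meet principality of [c] gives
    such a [z] in [L], and what remains is that [z] is principal. In a domain
    lattice a nonzero join principal element can be cancelled from inequalities
    ([join_principal_cancel]), so principality of [cz] descends to [z]
    ([principal_factor]). *)

Set Implicit Arguments.
Unset Strict Implicit.
Unset Printing Implicit Defensive.

Import Order.TTheory.

Local Open Scope classical_set_scope.
Local Open Scope order_scope.
Local Open Scope group_scope.

(** * Order and residuation in multiplicative lattices *)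

Section MultLatticeTheory.
Context (d : Order.disp_t) (L : multLatticeType d).
Implicit Types (a b c x y z u : L) (A B : set L).

Lemma bigjoin_ub A x : A x -> x <= bigjoin A.
Proof. by move=> Ax; have [ub _] := bigjoinP A; exact: ub. Qed.

Lemma bigjoin_le A x : (forall a, A a -> a <= x) -> bigjoin A <= x.
Proof. by move=> Ax; have [_ lub] := bigjoinP A; exact: lub. Qed.

Lemma bigjoin_mono A B : A `<=` B -> bigjoin A <= bigjoin B.
Proof. by move=> AB; apply: bigjoin_le => a /AB; exact: bigjoin_ub. Qed.

Lemma bigjoin_set2 x y : bigjoin [set x; y] = x `|` y.
Proof.
apply/le_anti/andP; split.
  by apply: bigjoin_le => _ [->|->]; rewrite ?leUl ?leUr.
by rewrite leUx !bigjoin_ub //=; [right|left].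
Qed.

Lemma mul_join x y z : x * (y `|` z) = (x * y) `|` (x * z).
Proof. by rewrite -!bigjoin_set2 mul_bigjoin image_setU !image_set1. Qed.

Lemma mul_bot x : x * \bot = \bot.
Proof.
have bot0 : \bot = bigjoin (@set0 L).
  by apply/eqP; rewrite eq_sym -lex0; apply: bigjoin_le.
by rewrite bot0 mul_bigjoin image_set0.
Qed.

Lemma le_mul2l x y z : y <= z -> x * y <= x * z.
Proof. by move=> /join_r yz; rewrite -yz mul_join leUl. Qed.

Lemma mul_le_l x y : x * y <= x.
Proof. by rewrite -[leRHS]mulg1 le_mul2l // one_top lex1. Qed.

(** Residuation by [b] is right adjoint to multiplication by [b]. *)
Lemma le_residual a b y : (y <= residual a b) = (b * y <= a).
Proof.
apply/idP/idP => [yr|]; last exact: bigjoin_ub.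
apply: le_trans (le_mul2l b yr) _.
by rewrite mul_bigjoin; apply: bigjoin_le => _ [z /= bz <-].
Qed.

Lemma eq_le_below x y : (forall u, (u <= x) = (u <= y)) -> x = y.
Proof. by move=> xy; apply/le_anti; rewrite xy lexx -xy lexx. Qed.

Lemma residual_mul a x y : residual a (x * y) = residual (residual a x) y.
Proof. by apply: eq_le_below => u; rewrite !le_residual mulgA. Qed.

(** * Principal elements *)

(** Meet principality without meets and residuals: this form only speaks of the
    order and the product, hence is transported by isomorphisms for free. *)
Lemma meet_principalP x :
  meet_principal x <->
  forall a b, a <= x * b -> exists2 c, c <= b & a = x * c.
Proof.
split=> [mx a b axb|fx a b].
  exists (residual a x `&` b); first exact: leIr.
  by rewrite -mx; apply/esym/meet_l.
apply/le_anti/andP; split; last first.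
  rewrite lexI (le_mul2l _ (leIr _ _)) andbT.
  by rewrite -le_residual leIl.
have [c cb ac] := fx _ _ (leIr (x * b) a).
rewrite ac; apply: le_mul2l.
by rewrite lexI cb le_residual -ac leIl.
Qed.

Lemma meet_principal_mul x y :
  meet_principal x -> meet_principal y -> meet_principal (x * y).
Proof.
move=> /meet_principalP mx /meet_principalP my; apply/meet_principalP => a b.
rewrite -mulgA => /mx [c /my [e eb ->] ->].
by exists e; rewrite ?mulgA.
Qed.

Lemma join_principal_mul x y :
  join_principal x -> join_principal y -> join_principal (x * y).
Proof.
move=> jx jy a b; rewrite !residual_mul jy jx.
by rewrite -mulgA [y * x]mulmC.
Qed.

Lemma principal_mul x y : principal x -> principal y -> principal (x * y).
Proof.
move=> [mx jx] [my jy].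
by split; [apply: meet_principal_mul | apply: join_principal_mul].
Qed.

Lemma principal1 : principal (1 : L).
Proof.
split=> [|a b].
  by apply/meet_principalP => a b; rewrite mul1g; exists a; rewrite ?mul1g.
have res1 c : residual c 1 = c.
  by apply: eq_le_below => u; rewrite le_residual mul1g.
by rewrite !res1 mulg1.
Qed.

Lemma principal_bot : principal (\bot : L).
Proof.
have bot_mul x : \bot * x = \bot by rewrite mulmC mul_bot.
split=> [|a b].
  apply/meet_principalP => a b; rewrite bot_mul lex0 => /eqP ->.
  by exists b; rewrite ?bot_mul.
have res0 c : residual c \bot = \top.
  by apply/le_anti; rewrite lex1 le_residual bot_mul le0x.
by rewrite !res0 joinx1.
Qed.

(** Join principality for the pair [(y, \bot)] reads
    [y \/ (0 : c) = (yc : c)], and [(0 : c) = 0] in a domain lattice. *)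
Lemma join_principal_cancel c x y :
  domain_lattice L -> join_principal c -> c <> \bot ->
  (c * x <= c * y) = (x <= y).
Proof.
move=> domL jc c0; apply/idP/idP => [cxy|]; last exact: le_mul2l.
have res0 : residual \bot c = \bot.
  have /eqP : c * residual \bot c = \bot.
    by apply/eqP; rewrite -lex0 -le_residual.
  by move/eqP/domL => [].
have := jc y \bot; rewrite res0 !joinx0 => ->.
by rewrite le_residual [y * c]mulmC.
Qed.

(** Multiplying by [c] turns the conditions for [z] into those for [c * z],
    which can then be cancelled back. *)
Lemma principal_factor c z :
  domain_lattice L -> join_principal c -> c <> \bot ->
  principal (c * z) -> principal z.
Proof.
move=> domL jc c0 [/meet_principalP mcz jcz].
have cancel := join_principal_cancel _ _ domL jc c0.
split.
  apply/meet_principalP => a b; rewrite -cancel mulgA => /mcz [e eb ae].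
  by exists e => //; apply/le_anti/andP; split; rewrite -cancel mulgA ae.
have res b : residual b z = residual (c * b) (c * z).
  by apply: eq_le_below => u; rewrite !le_residual -mulgA cancel.
move=> a b; rewrite !res jcz mul_join.
by rewrite [c * (a * z)]mulgA [c * a]mulmC mulgA.
Qed.

(** If [c] is the bottom then so is [y], and any principal [z] below [u]
    is a quotient; otherwise the quotient is principal by cancellation. *)
Lemma principal_divides c y u :
  domain_lattice L -> principal c -> principal y -> y <= c * u ->
  exists z, [/\ principal z, c * z = y & z <= u].
Proof.
move=> domL [/meet_principalP mc jc] py ycu.
have [c0|c0] := pselect (c = \bot).
  exists \bot; split; [exact: principal_bot | | exact: le0x].
  apply/esym/eqP; rewrite mul_bot -lex0.
  by move: ycu; rewrite c0 mulmC mul_bot.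
have [z zu yE] := mc _ _ ycu; exists z; split=> //.
by apply: (principal_factor domL jc c0); rewrite -yE.
Qed.

End MultLatticeTheory.

(** * The weak ideal system induced by a multiplicative map *)

Section Pullback.
Context (d : Order.disp_t) (L : multLatticeType d) (H : comMonoid0Type).
Context (j : H -> L) (jM : {morph j : x y / x * y}).
Implicit Types (X Y : set H).

Let closure X : set H := [set y | j y <= bigjoin (j @` X)].

Let bigjoin_scale c X : bigjoin (j @` scaleset c X) = j c * bigjoin (j @` X).
Proof.
rewrite mul_bigjoin !image_comp.
by congr bigjoin; apply: eq_imagel => x _ /=; rewrite jM.
Qed.

Let bigjoin_closure X : bigjoin (j @` closure X) = bigjoin (j @` X).
Proof.
apply/le_anti/andP; split; first by apply: bigjoin_le => _ [y + <-].
apply: bigjoin_mono => _ [x Xx <-]; exists x => //.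
by apply: bigjoin_ub; exists x.
Qed.

Let closure_absorb X : mulset X setT `<=` closure X.
Proof.
move=> _ [x Xx [h _ <-]]; rewrite /closure /= jM.
by apply: le_trans (mul_le_l _ _) _; apply: bigjoin_ub; exists x.
Qed.

Let closure_mono X Y : X `<=` Y -> closure X `<=` closure Y.
Proof.
move=> XY y yX; apply: le_trans yX _.
exact/bigjoin_mono/image_subset.
Qed.

Let closure_idem X : closure (closure X) = closure X.
Proof. by rewrite /closure -/(closure X) bigjoin_closure. Qed.

Let closure_scale c X : scaleset c (closure X) `<=` closure (scaleset c X).
Proof.
by move=> _ [y yX <-]; rewrite /closure /= bigjoin_scale jM; apply: le_mul2l.
Qed.

Definition pullback_system : weakIdealSystem H :=
  WeakIdealSystem closure_absorb closure_mono closure_idem closure_scale.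

(** Scaling commutes with the closure when a bound [j y <= j c * u] in [L] is
    always explained by a division of [y] by [c] inside [H]. *)
Lemma pullback_ideal_system :
  (forall c y u, j y <= j c * u -> exists2 z, c * z = y & j z <= u) ->
  ideal_system pullback_system.
Proof.
move=> divj c X; apply/seteqP; split; first exact: closure_scale.
move=> y; rewrite /= /closure /= bigjoin_scale => /divj [z zy zX].
by exists z.
Qed.

Lemma pullback_iso :
  generates (range j) -> mult_lattice_iso (rideal pullback_system) L.
Proof.
move=> genj; pose f (I : rideal pullback_system) : L := bigjoin (j @` val I).
have fixI (I : rideal pullback_system) x : val I x <-> j x <= f I.
  by rewrite -{1}(rideal_fix I).
have f_mk X : f (mk_rideal pullback_system X) = bigjoin (j @` X).
  by rewrite /f val_mk bigjoin_closure.
have f_le : {mono f : I J / I <= J}.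
  move=> I J; apply/idP/rideal_leP => [fIJ x /fixI xI|IJ].
    by apply/fixI; exact: le_trans fIJ.
  exact/bigjoin_mono/image_subset.
(* The ideal of all [h] with [j h <= x] is the preimage of [x] because the
   range of [j] generates. *)
have f_below x : f (mk_rideal pullback_system [set h | j h <= x]) = x.
  rewrite f_mk; apply/le_anti/andP; split.
    by apply: bigjoin_le => _ [h + <-].
  have [A Aj ->] := genj x; apply: bigjoin_mono => a Aa.
  have [h _ ha] := Aj a Aa; exists h => //=.
  by rewrite ha bigjoin_ub.
exists f; split=> //.
  exists (fun x => mk_rideal pullback_system [set h | j h <= x]) => // I.
  by apply/le_anti/andP; split; rewrite -f_le f_below.
move=> I J; rewrite [f (I * J)]f_mk /f.
apply/le_anti/andP; split.
  apply: bigjoin_le => _ [_ [x Ix [y Jy <-]] <-]; rewrite jM.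
  apply: le_trans (le_mul2l _ (_ : _ <= bigjoin (j @` val J))) _.
    by apply: bigjoin_ub; exists y.
  rewrite mulmC [leRHS]mulmC; apply: le_mul2l.
  by apply: bigjoin_ub; exists x.
rewrite mul_bigjoin; apply: bigjoin_le => _ [_ [y Jy <-] <-].
rewrite mulmC mul_bigjoin; apply: bigjoin_le => _ [_ [x Ix <-] <-].
rewrite mulmC -jM; apply: bigjoin_ub; exists (x * y) => //.
by exists x => //; exists y.
Qed.

End Pullback.

(** * Submonoids containing the bottom *)

Section Submonoid.
Context (d : Order.disp_t) (L : multLatticeType d) (C : set L).
Hypotheses (C1 : C 1) (C0 : C \bot).
Hypothesis CM : forall x y, C x -> C y -> C (x * y).

(** The closure proofs are parameters of the type, so that the monoid structure
    below can be inferred from it. *)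
Definition submonoid_of (_ : C 1) (_ : C \bot)
  (_ : forall x y, C x -> C y -> C (x * y)) : Type := set_type C.

Local Notation S := (submonoid_of C1 C0 CM).

HB.instance Definition _ := SubChoice.on S.

Let memC (x : S) : C (val x). Proof. exact: set_mem (valP x). Qed.

Let inS x (Cx : C x) : S := Sub x (mem_set Cx).

Let one : S := inS C1.
Let mul (x y : S) : S := inS (CM (memC x) (memC y)).

Let mulA : associative mul.
Proof. by move=> x y z; apply: val_inj; rewrite !SubK mulgA. Qed.
Let mul1 : left_id one mul.
Proof. by move=> x; apply: val_inj; rewrite !SubK mul1g. Qed.
Let mulC : commutative mul.
Proof. by move=> x y; apply: val_inj; rewrite !SubK mulmC. Qed.
Let mul1r : right_id one mul.
Proof. by move=> x; rewrite mulC mul1. Qed.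

HB.instance Definition _ := isMonoid.Build S mulA mul1 mul1r.
HB.instance Definition _ := Monoid_isCommutative.Build S mulC.

Let mul0 : left_zero (inS C0) mul.
Proof. by move=> x; apply: val_inj; rewrite !SubK mulmC mul_bot. Qed.

HB.instance Definition _ := hasAbsorbing.Build S mul0.

Definition submonoid0 : comMonoid0Type := S.

Definition submonoid_val (x : submonoid0) : L := val (x : S).

Lemma submonoid_valM : {morph submonoid_val : x y / x * y}.
Proof. by []. Qed.

Lemma submonoid_val_inj : injective submonoid_val.
Proof. exact: val_inj. Qed.

Lemma range_submonoid_val : range submonoid_val = C.
Proof.
apply/seteqP; split=> [_ [x _ <-]|x Cx]; first exact: memC.
by exists (inS Cx).
Qed.

End Submonoid.

Arguments submonoid_valM {d L C C1 C0 CM}.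
Arguments submonoid_val_inj {d L C C1 C0 CM}.

(** * Lattices of ideals of an ideal system *)

Section IdealSystem.
Context (H : comMonoid0Type) (r : weakIdealSystem H).
Implicit Types (c : H) (I J K : rideal r).

Lemma mulset1l c (X : set H) : mulset [set c] X = scaleset c X.
Proof.
apply/seteqP; split=> [_ [_ -> [x Xx <-]]|_ [x Xx <-]]; first by exists x.
by exists c => //; exists x.
Qed.

Lemma rclos1_mul c (X : set H) :
  mk_rideal r [set c] * mk_rideal r X = mk_rideal r (scaleset c X).
Proof.
apply: val_inj; rewrite [LHS]val_mk !val_mk.
by rewrite rclos_mulsetr rclos_mulsetl mulset1l.
Qed.

Lemma mk_rideal_val I : mk_rideal r (val I) = I.
Proof. by apply: val_inj; rewrite val_mk rideal_fix. Qed.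

Lemma rclos1_meet_principal c :
  ideal_system r -> meet_principal (mk_rideal r [set c]).
Proof.
move=> idr; apply/meet_principalP => K J.
rewrite -{1}(mk_rideal_val J) rclos1_mul => /rideal_leP.
(* Equality in the scaling axiom makes the product the bare set [cJ]. *)
rewrite val_mk -idr rideal_fix => KcJ.
exists (mk_rideal r [set h | val J h /\ val K (c * h)]).
  by apply/rideal_leP; rewrite val_mk; apply/rclos_sub => h [].
rewrite rclos1_mul -[LHS]mk_rideal_val; congr (mk_rideal r _).
apply/seteqP; split=> [k Kk|_ [h [_ Kch] <-] //].
by have [h Jh hk] := KcJ k Kk; exists h => //; split; rewrite ?hk.
Qed.

Lemma rideal_bigjoin_rclos1 I :
  I = bigjoin [set mk_rideal r [set c] | c in val I].
Proof.
apply/le_anti/andP; split; last first.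
  apply: bigjoin_le => _ [c Ic <-]; apply/rideal_leP; rewrite val_mk.
  by apply/rclos_sub => _ ->.
apply/rideal_leP => c Ic.
have /rideal_leP : mk_rideal r [set c] <=
    bigjoin [set mk_rideal r [set c] | c in val I].
  by apply: bigjoin_ub; exists c.
by apply; rewrite val_mk; apply: sub_rclos.
Qed.

Lemma ideal_system_generated :
  ideal_system r -> generates [set I : rideal r | meet_principal I].
Proof.
move=> idr I; exists [set mk_rideal r [set c] | c in val I].
  by move=> _ [c _ <-]; exact: rclos1_meet_principal.
exact: rideal_bigjoin_rclos1.
Qed.

End IdealSystem.

Lemma iso_generated_meet_principal (d d' : Order.disp_t)
    (L : multLatticeType d) (L' : multLatticeType d') :
  mult_lattice_iso L L' -> generates [set x : L | meet_principal x] ->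
  generates [set x : L' | meet_principal x].
Proof.
move=> [f [[g fK gK] f_le fM]] genL y.
have [A Amp gy] := genL (g y); exists (f @` A).
  move=> _ [x /Amp /meet_principalP mx <-]; apply/meet_principalP => a b.
  rewrite -{1}(gK a) -{1}(gK b) -fM f_le => /mx [c cb ac].
  by exists (f c); rewrite -?fM -?ac ?gK // -(gK b) f_le.
rewrite -(gK y) gy; apply/le_anti/andP; split; last first.
  by apply: bigjoin_le => _ [x Ax <-]; rewrite f_le bigjoin_ub.
rewrite -[leRHS]gK f_le; apply: bigjoin_le => x Ax.
by rewrite -f_le gK; apply: bigjoin_ub; exists x.
Qed.

Theorem proposition7 :
  (forall (d : Order.disp_t) (L : multLatticeType d),
     liftable_to_weak_ideal_system L) /\
  (forall (d : Order.disp_t) (L : multLatticeType d),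
     liftable_to_ideal_system L ->
     generates [set x : L | meet_principal x]%classic) /\
  (forall (d : Order.disp_t) (L : multLatticeType d),
     domain_lattice L ->
     generates [set x : L | principal x]%classic ->
     liftable_to_ideal_system L).
Proof.
split; last split.
- move=> d L.
  pose j := @submonoid_val d L setT I I (fun _ _ _ _ => I).
  exists _, (pullback_system (submonoid_valM : {morph j : x y / x * y})).
  apply: pullback_iso; rewrite range_submonoid_val => x; exists [set x] => //.
  apply/le_anti; rewrite bigjoin_ub //=.
  by apply: bigjoin_le => _ ->.
- move=> d L [H [r [idr iso]]].
  exact: iso_generated_meet_principal iso (ideal_system_generated idr).
move=> d L domL genL.
pose j := @submonoid_val d L [set x | principal x]
  (principal1 L) (principal_bot L) (@principal_mul d L).
have rangej : range j = [set x | principal x] by exact: range_submonoid_val.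
exists _, (pullback_system (submonoid_valM : {morph j : x y / x * y})).
split; last by apply: pullback_iso; rewrite rangej.
apply: pullback_ideal_system => c y u ycu.
have pj h : principal (j h).
  by have : range j (j h) by [exists h]; rewrite rangej.
have [z [pz czy zu]] := principal_divides domL (pj c) (pj y) ycu.
have [h _ hz] : range j z by rewrite rangej.
exists h; last by rewrite hz.
by apply: submonoid_val_inj; rewrite submonoid_valM -/j hz.
Qed.
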